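(* Let $G$ be a graph of order $n$ having neither a component of order less than $3$ nor a component isomorphic to $K_{1,1+2u}$ for $u\in\{1,2\}$. Then (i) $s_g(G)=n$ if $n\equiv 1\pmod 2$; (ii) $s_g(G)\leq n+3$ if $n\equiv 0\pmod 2$.
   Context: Graphs are finite, simple and undirected; components are connected components, and the order of a graph is its number of vertices. For a finite Abelian group $\Gamma$ (written additively) and an edge labeling $f\colon E(G)\to\Gamma$, the weighted degree of a vertex $v$ is $w(v)=\sum_{u\in N(v)}f(uv)$, computed in $\Gamma$. The labeling $f$ is called $\Gamma$-irregular if $w(u)\neq w(v)$ for all distinct $u,v\in V(G)$. The group irregularity strength $s_g(G)$ is the smallest integer $s$ such that for every Abelian group $\Gamma$ of order $s$ there exists a $\Gamma$-irregular labeling of $G$. $K_{1,r}$ denotes the star with $r$ leaves. *)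

(* Defs.v *)
From HB Require Import structures.
From mathcomp Require Import all_boot all_order all_algebra.

Set Implicit Arguments.
Unset Strict Implicit.
Unset Printing Implicit Defensive.

Import GRing.Theory.

Record sgraph := SGraph {
  vertex :> finType;
  adj : rel vertex;
  adj_sym : symmetric adj;
  adj_irrefl : irreflexive adj }.

Definition components (G : sgraph) : {set {set G}} :=
  [set [set y | connect (@adj G) x y] | x : G].

Section Induced.
Variables (G : sgraph) (A : {set G}).

Definition induced_adj : rel {x : G | x \in A} :=
  fun x y => adj (val x) (val y).

Lemma induced_adj_sym : symmetric induced_adj.
Proof. by move=> x y; apply: adj_sym. Qed.

Lemma induced_adj_irrefl : irreflexive induced_adj.
Proof. by move=> x; apply: adj_irrefl. Qed.

Definition induced : sgraph := SGraph induced_adj_sym induced_adj_irrefl.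
End Induced.

Section Star.
Variable r : nat.

(* [None] is the centre and [Some i] the leaves. *)
Definition star_adj : rel (option 'I_r) :=
  fun x y => (x == None) != (y == None).

Lemma star_adj_sym : symmetric star_adj.
Proof. by move=> x y; rewrite /star_adj eq_sym. Qed.

Lemma star_adj_irrefl : irreflexive star_adj.
Proof. by move=> x; rewrite /star_adj eqxx. Qed.

Definition star : sgraph := SGraph star_adj_sym star_adj_irrefl.
End Star.

Definition isomorphic (G H : sgraph) : Prop :=
  exists2 h : G -> H, bijective h & forall x y, adj (h x) (h y) = adj x y.

(* The edge uv is the set [set u; v]; a labelling is a total function on vertex
   sets, of which only the values on edges enter the weighted degrees. *)
Definition weight (G : sgraph) (Gamma : finZmodType) (f : {set G} -> Gamma)
    (v : G) : Gamma :=
  (\sum_(u | adj v u) f [set u; v])%R.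

Definition irregular_labeling (G : sgraph) (Gamma : finZmodType)
    (f : {set G} -> Gamma) : Prop :=
  forall u v : G, u != v -> weight f u != weight f v.

Definition group_irregular (G : sgraph) (s : nat) : Prop :=
  forall Gamma : finZmodType, #|Gamma| = s ->
    exists f : {set G} -> Gamma, irregular_labeling f.

(* s_g(G) = s.  Positivity is needed because there is no group of order 0, so
   that [group_irregular G 0] holds vacuously. *)
Definition is_group_irregularity_strength (G : sgraph) (s : nat) : Prop :=
  [/\ 0 < s, group_irregular G s
    & forall t : nat, 0 < t -> group_irregular G t -> s <= t].

(* Main.v *)
Require Import Defs.
From HB Require Import structures.
From mathcomp Require Import all_boot all_order all_algebra.
From mathcomp Require Import all_fingroup all_solvable.
From mathcomp Require Import zify ring.
From Stdlib Require Import Classical_Prop.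

(** Labelling the edges of a walk alternately by a and -a changes the weights of
    its two ends only, by a and -a if the walk is even and by a and a if it is
    odd.  Hence a pair of vertices joined by an even walk may receive weights
    (g, -g), three vertices joined by even walks a zero-sum triple, and three
    vertices u, v, w with odd walks from u to v and w a triple (a + b, a, b).
    Every component other than K_1, K_2 and K_{1,3} splits into such gadgets: the
    bipartition classes are cut into pairs, after at most two triples have fixed
    the parities.

    In a group of odd order N these weights come from disjoint six-element sets
    {x, y, -(x+y), -x, -y, x+y}, each serving two triples of the same kind; the
    other nonzero elements form pairs {g, -g}.  One needs l six-sets as soon as
    6 l + 3 <= N.  In a cyclic group they come from triples a + d = b of integers.
    A noncyclic group H maps onto F_p x F_p for some prime p, whose nonzero vectors
    (for p = 3, those outside a line) carry a system of zero-sum triples that lifts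
    to H coset by coset, and one recurses on the remaining subgroup. *)

Set Implicit Arguments.
Unset Strict Implicit.
Unset Printing Implicit Defensive.

Import GRing.Theory FinRing.Theory.

(** * Six-sets and their construction in cyclic groups of odd order *)

Section SignedTriples.
Local Open Scope ring_scope.
Variable U : finZmodType.

(* Zero-sum triples [(x, y, z)] are encoded by the pairs [(x, y)]. *)
Definition sixset (t : U * U) : seq U :=
  [:: t.1; t.2; - (t.1 + t.2); - t.1; - t.2; t.1 + t.2].

Definition sixsets (ts : seq (U * U)) : seq U := flatten (map sixset ts).

Lemma size_sixsets ts : size (sixsets ts) = (6 * size ts)%N.
Proof. by elim: ts => //= t ts; rewrite -/(sixsets ts) => ->; lia. Qed.

Lemma sixsets_cat ts1 ts2 : sixsets (ts1 ++ ts2) = sixsets ts1 ++ sixsets ts2.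
Proof. by rewrite /sixsets map_cat flatten_cat. Qed.

End SignedTriples.

(* A Skolem-type partition of [1 .. 3m+1] minus one point: after the differences
   [1 .. m] come nested pairs with all the odd differences, then nested pairs with
   the even ones, around the point left out. *)
Lemma skolem_triples (m : nat) : exists a : nat -> nat,
  uniq (iota 1 m ++ map a (iota 1 m) ++ map (fun d => a d + d) (iota 1 m)) /\
  (forall d, d \in iota 1 m -> 0 < a d /\ a d + d <= 3 * m + 1).
Proof.
(* With h = [uphalf m], the pairs with odd differences fill m + 1, ..., m + 2 h symmetrically about
   the middle of this interval. Those with even differences are symmetric about the omitted point m
   + 2 h + [m./2] + 1 and end at 3 m + 1. *)
pose a d := if odd d then m + uphalf m - d./2
            else m + 2 * uphalf m + m./2 + 1 - d./2.
have aE d : odd d -> a d = m + uphalf m - d./2 by rewrite /a => ->.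
have aE' d : ~~ odd d -> a d = m + 2 * uphalf m + m./2 + 1 - d./2.
  by rewrite /a => /negbTE ->.
have hE d : d = odd d + d./2 + d./2 by rewrite -addnA addnn odd_double_half.
have hm := hE m; have um := uphalf_half m.
have key d1 d2 : d1 \in iota 1 m -> d2 \in iota 1 m ->
  [/\ a d1 = a d2 -> d1 = d2, a d1 + d1 = a d2 + d2 -> d1 = d2,
      m < a d1, a d1 + d1 <= 3 * m + 1 & a d1 != a d2 + d2].
  rewrite !mem_iota => h1 h2; have e1 := hE d1; have e2 := hE d2.
  case o1: (odd d1) e1 => e1; case o2: (odd d2) e2 => e2;
  rewrite ?(aE _ o1) ?(aE _ o2) ?(aE' _ (negbT o1)) ?(aE' _ (negbT o2));
  move: um hm h1 h2 e1 e2; case: (odd m) => /=; move: d1./2 d2./2 m./2 (uphalf m) => x y z u; split; lia.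
exists a; split; last first.
  by move=> d hd; have [_ _ h1 h2 _] := key d d hd hd; split; lia.
rewrite !cat_uniq iota_uniq /= !map_inj_in_uniq ?iota_uniq /=; first last.
- by move=> x y hx hy; have [h _ _ _ _] := key _ _ hx hy.
- by move=> x y hx hy; have [_ h _ _ _] := key _ _ hx hy.
rewrite andbT; apply/andP; split; apply/hasPn => x.
- rewrite mem_cat => /orP[] /mapP[d hd ->]; have [_ _ h1 h2 _] := key d d hd hd;
  rewrite /= mem_iota; lia.
- case/mapP=> d hd ->; apply/negP=> /mapP[e he eq].
  by have [_ _ _ _ /eqP[]] := key _ _ he hd.
Qed.

Section Odd.
Local Open Scope ring_scope.
Variable U : finZmodType.
Hypothesis oddU : odd #|U|.

Lemma mulrn_card (x : U) : x *+ #|U| = 0.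
Proof.
have := expg_cardG (in_setT x); rewrite cardsT.
by rewrite zmodXgE zmod1gE.
Qed.

(** For odd N = [#|U|] the multiplier (N + 1) / 2 inverts doubling. *)
Definition half (x : U) : U := x *+ uphalf #|U|.

Lemma half_add (x : U) : half x + half x = x.
Proof.
rewrite /half -mulrnDr addnn uphalf_half oddU.
have -> : ((true + #|U|./2).*2 = #|U| + 1)%N.
  by have := odd_double_half #|U|; rewrite oddU /=; lia.
by rewrite mulrnDr mulrn_card add0r.
Qed.

Lemma double_inj : injective (fun x : U => x + x).
Proof.
move=> x y /= /(congr1 half); rewrite /half.
by rewrite !mulrnDl -!/(half _) !half_add.
Qed.

Lemma neq_oppr (x : U) : x != 0 -> - x != x.
Proof.
apply: contra => /eqP h; apply/eqP; apply: double_inj => /=.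
by rewrite -{1}h addNr addr0.
Qed.

(** In odd order no nonzero element is its own negative, so each pair {x, -x} has a well-defined
    member of smaller [enum_rank]; these members form [r]. *)
Lemma half_list (S : {set U}) :
  0 \notin S -> {in S, forall x, - x \in S} ->
  exists r : seq U, perm_eq (r ++ map -%R r) (enum S).
Proof.
move=> S0 SN; pose P (x : U) := (enum_rank x < enum_rank (- x)%R)%N.
have PN x : x \in S -> P (- x) = ~~ P x.
  move=> xS; rewrite /P opprK -leqNgt ltn_neqAle.
  suff -> : nat_of_ord (enum_rank (- x)) != enum_rank x by [].
  apply/negP=> /eqP /val_inj /enum_rank_inj /eqP; apply/negP.
  by apply: neq_oppr; apply: contraNneq S0 => <-.
pose r := [seq x <- enum S | P x].
have memr x : (x \in r) = P x && (x \in S) by rewrite mem_filter mem_enum.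
exists r; apply: uniq_perm; last 1 first.
- move=> x; have -> : (x \in r ++ map -%R r) = (x \in r) || (- x \in r).
    by rewrite mem_cat -{2}(opprK x) (mem_map oppr_inj).
  rewrite !memr mem_enum.
  case xS: (x \in S); first by rewrite PN // SN // ; case: (P x).
  by rewrite !andbF; apply/negbTE/negP=> /andP[_] /SN; rewrite opprK xS.
- rewrite cat_uniq (map_inj_uniq oppr_inj) filter_uniq ?enum_uniq //=.
  rewrite andbT; apply/hasPn=> _ /mapP[x /[!memr] /andP[Px xS] ->].
  by rewrite PN // Px.
- exact: enum_uniq.
Qed.

(** The integer triples d + [a d] = b are multiplied by a generator. All their entries lie strictly
    between 0 and N / 2, so these multiples and their negatives are distinct and nonzero. *)
Lemma cyclic_sixsets (H : {group U}) : cyclic H ->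
  exists ts : seq (U * U),
   [/\ uniq (sixsets ts), all (fun x => (x != 0) && (x \in H)) (sixsets ts)
     & (#|H| <= 6 * size ts + 7)%N].
Proof.
case/cyclicP=> g Hg; have oN : odd #|H|.
  by apply: dvdn_odd oddU; rewrite -cardsT cardSg // subsetT.
pose N := #|H|; have NE : N = #[g]%g by rewrite /N Hg.
have gE (i j : nat) : (g *+ i == g *+ j) = (i == j %[mod N]).
  by rewrite NE -eq_expg_mod_order !zmodXgE.
have gH i : g *+ i \in H by rewrite -zmodXgE Hg mem_cycle.
have gN i : - (g *+ i) \in H by rewrite -zmodVgE groupV gH.
(* For N >= 3 this is the largest m with 6 m + 3 <= N, that is, with 2 (3 m + 1) < N. *)
pose m := ((N - 3) %/ 6)%N.
have hm : (6 * m <= N - 3)%N by rewrite mulnC leq_divM.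
have hm' : (N - 3 < 6 * m + 6)%N.
  by have := ltn_ceil (N - 3) (isT : 0 < 6)%N; rewrite -/m; lia.
have N_gt0 : (0 < N)%N by rewrite cardG_gt0.
have [a [Ku Kb]] := skolem_triples m.
pose ts := [seq (g *+ d, g *+ a d) | d <- iota 1 m].
set K := iota 1 m ++ _ in Ku.
have KB d : d \in K -> (0 < d)%N /\ (2 * d < N)%N.
  have mN : (0 < m)%N -> (6 * m + 3 <= N)%N by lia.
  have mP e : e \in iota 1 m -> (0 < m)%N by rewrite mem_iota; lia.
  rewrite !mem_cat => /or3P[hd|/mapP[e he ->]|/mapP[e he ->]].
  - by have := mN (mP _ hd); move: hd; rewrite mem_iota; lia.
  - by have := mN (mP _ he); have := Kb _ he; lia.
  - by have := mN (mP _ he); have := Kb _ he; lia.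
have sz : size ts = m by rewrite size_map size_iota.
(* [L] rearranges the six-sets. One inclusion and equal lengths suffice to carry its freedom from
   repetitions over to [sixsets ts]. *)
pose L := map (fun d => g *+ d) K ++ map (fun d => - (g *+ d)) K.
have oppE i : (i <= N)%N -> - (g *+ i) = g *+ (N - i).
  move=> iN; apply/eqP; rewrite eq_sym -addr_eq0 -mulrnDr subnK //.
  by rewrite -(mulr0n g) gE modnn mod0n.
have gI : {in K &, forall i j, (i == j %[mod N]) = (i == j)}.
  by move=> i j /KB [_ hi] /KB[_ hj]; rewrite !modn_small //; lia.
have Lu : uniq L.
  rewrite cat_uniq !map_inj_in_uniq ?Ku //=; first last.
  - by move=> i j hi hj /eqP; rewrite gE gI // => /eqP.
  - by move=> i j hi hj /eqP; rewrite eqr_opp gE gI // => /eqP.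
  rewrite andbT; apply/hasPn=> _ /mapP[d hd ->]; apply/negP=> /mapP[e he].
  move: (KB _ hd) (KB _ he) => [d0 d1] [e0 e1].
  by rewrite oppE; last lia; move/eqP; rewrite gE !modn_small; lia.
have LT : {subset L <= sixsets ts}.
  have mT d x : d \in iota 1 m -> x \in sixset (g *+ d, g *+ a d) -> x \in sixsets ts.
    move=> hd hx; apply/flatten_mapP; exists (g *+ d, g *+ a d) => //.
    exact: map_f.
  move=> x; rewrite mem_cat => /orP[] /mapP[d]; rewrite !mem_cat;
    case/or3P=> [hd|/mapP[e he ->]|/mapP[e he ->]] ->.
  - by apply: (mT _ _ hd); rewrite !inE eqxx.
  - by apply: (mT _ _ he); rewrite !inE eqxx ?orbT.
  - by apply: (mT _ _ he); rewrite !inE mulrnDr addrC eqxx ?orbT.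
  - by apply: (mT _ _ hd); rewrite !inE eqxx ?orbT.
  - by apply: (mT _ _ he); rewrite !inE eqxx ?orbT.
  - by apply: (mT _ _ he); rewrite !inE mulrnDr [X in - X]addrC eqxx ?orbT.
have szLT : (size (sixsets ts) = size L)%N.
  by rewrite size_sixsets sz size_cat !size_map /K !size_cat !size_map size_iota; lia.
(* The choice of m leaves N <= 6 m + 8, and oddness of N lowers the bound to 6 m + 7. *)
exists ts; split; last by rewrite sz; rewrite -/N; move: oN; rewrite -/N; lia.
  by apply: leq_size_uniq Lu LT _; rewrite szLT.
have [_ LE] := uniq_min_size Lu LT (eq_leq szLT).
apply/allP=> x; rewrite -LE mem_cat => /orP[] /mapP[d /KB[d0 d1] ->].
- by rewrite gH andbT -(mulr0n g) gE mod0n modn_small; lia.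
- by rewrite gN andbT oppr_eq0 -(mulr0n g) gE mod0n modn_small; lia.
Qed.

End Odd.

(** * Triple systems and their lifts along surjections *)

Section TripleSystems.
Local Open Scope ring_scope.

Definition third (U : zmodType) (b : U -> U) (x : U) : U := - (x + b x).

Definition covered (U : zmodType) (V : {pred U}) (b : U -> U) (x : U) : Prop :=
  [\/ x \in V, exists2 y, y \in V & x = b y
    | exists2 y, y \in V & x = third b y].

(* Zero-sum triples [(x, b x, third b x)], one for each [x] in [V], such that the
   negative of a triple is again a triple and no element is used twice. *)
Record triple_system (U : zmodType) (V : {pred U}) (b : U -> U) : Prop :=
  TripleSystem {
    ts_opp : {in V, forall x, - x \in V};
    ts_odd : {in V, forall x, b (- x) = - b x};
    ts_inj : {in V &, injective b};
    ts_inj3 : {in V &, injective (third b)};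
    ts_nz : ~ covered V b 0;
    ts_12 : {in V &, forall x y, b x != y};
    ts_13 : {in V &, forall x y, third b x != y};
    ts_23 : {in V &, forall x y, third b x != b y} }.

Variable U : finZmodType.
Hypothesis oddU : odd #|U|.

(** Since [b] is odd, the triples of x and -x together form one six-set; hence one x is taken from
    each pair {x, -x} in [V]. *)
Lemma triple_system_sixsets (V : {set U}) (b : U -> U) :
  triple_system V b ->
  exists2 ts : seq (U * U), uniq (sixsets ts)
    & forall x, x \in sixsets ts <-> covered V b x.
Proof.
move=> [VN bN bI cI V0 b12 b13 b23].
have V0' : 0 \notin V.
  by apply/negP=> h; apply: V0; constructor 1.
have [r Er] := half_list oddU V0' VN.
pose L := enum V ++ map b (enum V) ++ map (third b) (enum V).
have memL x : x \in L <-> covered V b x.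
  rewrite !mem_cat mem_enum; split=> [/or3P[xV|/mapP[y]|/mapP[y]]|].
  - by constructor 1.
  - by rewrite mem_enum => yV ->; constructor 2; exists y.
  - by rewrite mem_enum => yV ->; constructor 3; exists y.
  - by case=> [->//|[y yV ->]|[y yV ->]]; rewrite (map_f _ (_ : y \in enum V)) ?mem_enum ?orbT.
have Lu : uniq L.
  rewrite !cat_uniq enum_uniq !map_inj_in_uniq ?enum_uniq //=; first last.
  - by move=> x y; rewrite !mem_enum; apply: bI.
  - by move=> x y; rewrite !mem_enum; apply: cI.
  rewrite andbT; apply/andP; split; apply/hasPn=> x.
  - rewrite mem_cat => /orP[] /mapP[y]; rewrite mem_enum => yV ->;
    apply/negP; rewrite mem_enum => h.
    + by have := b12 _ _ yV h; rewrite eqxx.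
    + by have := b13 _ _ yV h; rewrite eqxx.
  - move=> /mapP[y]; rewrite mem_enum => yV ->; apply/negP=> /mapP[z].
    by rewrite mem_enum => zV /eqP; rewrite (negbTE (b23 _ _ yV zV)).
pose ts := [seq (x, b x) | x <- r].
have mT x y : x \in r -> y \in sixset (x, b x) -> y \in sixsets ts.
  by move=> hx hy; apply/flatten_mapP; exists (x, b x) => //; apply: map_f.
have rV x : x \in V -> exists2 y, y \in r & y \in V /\ (x = y \/ x = - y).
  move=> xV; have : x \in r ++ map -%R r by rewrite (perm_mem Er) mem_enum.
  rewrite mem_cat => /orP[xr|/mapP[y yr e]]; [exists x | exists y] => //;
  by split; [rewrite -mem_enum -(perm_mem Er) mem_cat ?xr ?yr | auto].
have LT : {subset L <= sixsets ts}.
  move=> x; rewrite !mem_cat => /or3P[|/mapP[y]|/mapP[y]]; rewrite mem_enum;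
  case/rV=> z zr [zV [->|->]]; rewrite /third ?[b (- z)]bN //; try move=> ->;
  by apply: (mT _ _ zr); rewrite !inE /= ?opprD ?opprK ?eqxx ?orbT.
have sz : size (sixsets ts) = size L.
  have := perm_size Er; rewrite size_sixsets size_map !size_cat !size_map.
  by move: (size r) (size (enum V)) => p q; lia.
exists ts; first by apply: leq_size_uniq Lu LT _; rewrite sz.
by move=> x; have [_ h] := uniq_min_size Lu LT (eq_leq sz); rewrite -h memL.
Qed.

Variables (H : {group U}) (K : zmodType) (phi : U -> K).
Hypothesis phiD : {in H &, {morph phi : x y / x + y}}.
Hypothesis phi_onto : forall v, exists2 x, x \in H & phi x = v.

Let HD x y : x \in H -> y \in H -> x + y \in H.
Proof. by rewrite -zmodMgE; apply: groupM. Qed.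
Let HN x : x \in H -> - x \in H.
Proof. by rewrite -zmodVgE groupV. Qed.
Let H0 : 0 \in H.
Proof. by rewrite -zmod1gE group1. Qed.
Let phi0 : phi 0 = 0.
Proof. by apply: (addIr (phi 0)); rewrite -phiD // !add0r. Qed.
Let phiN : {in H, {morph phi : x / - x}}.
Proof.
by move=> x xH; apply/eqP; rewrite -addr_eq0 -phiD ?HN // addNr phi0.
Qed.
Let phiMn k x : x \in H -> phi (x *+ k) = phi x *+ k.
Proof.
move=> xH; elim: k => [|k IH]; first by rewrite !mulr0n.
by rewrite !mulrSr phiD ?IH // -zmodXgE groupX.
Qed.

Let Hhalf x : x \in H -> half x \in H.
Proof. by move=> xH; rewrite /half -zmodXgE groupX. Qed.

(** Any section s0 is made odd by passing to (s0 v - s0 (-v)) / 2, halves being available in [H]. *)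
Lemma odd_section : exists s : K -> U,
  [/\ forall v, s v \in H, forall v, phi (s v) = v & forall v, s (- v) = - s v].
Proof.
have ex v : exists x, (x \in H) && (phi x == v).
  by have [x xH <-] := phi_onto v; exists x; rewrite xH eqxx.
pose s0 v := xchoose (ex v).
have s0H v : s0 v \in H by have /andP[] := xchooseP (ex v).
have s0E v : phi (s0 v) = v by have /andP[_ /eqP] := xchooseP (ex v).
have hN (x : U) : half (- x) = - half x by rewrite /half mulNrn.
pose s v := half (s0 v) - half (s0 (- v)).
exists s; split=> v.
- by rewrite HD ?HN ?Hhalf.
- rewrite /s -hN phiD ?Hhalf ?HN //.
  have hK x : x \in H -> phi (half x) = phi x *+ uphalf #|U| by apply: phiMn.
  rewrite hK // hK ?HN // phiN // !s0E opprK -mulrnDr.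
  have -> : (uphalf #|U| + uphalf #|U| = #|U| + 1)%N.
    by rewrite addnn uphalf_half oddU; have := odd_double_half #|U|; rewrite oddU /=; lia.
  have [x xH <-] := phi_onto v; rewrite mulrnDr.
  suff -> : phi x *+ #|U| = 0 by rewrite add0r.
  by rewrite -phiMn // mulrn_card phi0.
- by rewrite /s opprK opprB.
Qed.

(* On each coset the lifted map is a translation [x |-> x + t], so that it is
   injective and its third map [x |-> - (2 x + t)] is injective too, 2 being
   invertible. *)
Lemma lift_sixsets (V : {pred K}) (b : K -> K) : triple_system V b ->
  exists2 ts : seq (U * U), uniq (sixsets ts) &
    forall x, x \in sixsets ts <-> x \in H /\ covered V b (phi x).
Proof.
move=> [VN bN bI cI V0 b12 b13 b23].
have [s [sH sE sN]] := odd_section.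
pose t x := s (b (phi x) - phi x).
pose B x := x + t x.
pose W := [set x in H | phi x \in V].
have tH x : t x \in H by apply: sH.
have WP x : x \in W -> x \in H /\ phi x \in V by rewrite inE => /andP[].
have BH x : x \in W -> B x \in H by case/WP=> xH _; apply: HD.
have phiB x : x \in W -> phi (B x) = b (phi x).
  by case/WP=> xH xV; rewrite phiD // sE addrC subrK.
have phiC x : x \in W -> phi (third B x) = third b (phi x).
  by move=> xW; have [xH _] := WP _ xW; rewrite phiN ?HD ?BH // phiD ?BH // phiB.
have cov x : covered (mem W) B x <-> x \in H /\ covered V b (phi x).
  split=> [[/WP[xH xV]|[y yW ->]|[y yW ->]]|[xH]].
  - by split=> //; constructor 1.
  - have [yH yV] := WP _ yW; split; first exact: BH.
    by constructor 2; exists (phi y); rewrite ?phiB.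
  - have [yH yV] := WP _ yW; split; first by rewrite HN ?HD ?BH.
    by constructor 3; exists (phi y); rewrite ?phiC.
  case=> [xV|[v vV e]|[v vV e]].
  + by constructor 1; rewrite inE xH xV.
  + have e' : phi (x - s (b v - v)) = v.
      by rewrite phiD ?HN // phiN // sE e opprB addrC subrK.
    constructor 2; exists (x - s (b v - v)); first by rewrite inE HD ?HN // e'.
    by rewrite /B /t e' subrK.
  (* On the coset over [v] the translation is by t = [s (b v - v)], and y solves -(2 y + t) = x. *)
  + pose y := half (- x - s (b v - v)).
    have yH : y \in H by rewrite Hhalf ?HD ?HN.
    have yy : y + y = - x - s (b v - v) by rewrite half_add.
    have e' : phi y = v.
      have : phi y + phi y = v + v.
        rewrite -phiD // yy phiD ?HN // !phiN // sE e /third opprK opprB.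
        by rewrite addrACA subrr addr0.
      (* Nothing is assumed on the order of [K]; doubling is injective there because [K] is an image
         of [H], where elements can be halved. *)
      have [z zH <-] := phi_onto v; rewrite -!phiD // => h.
      have : phi (y - z + (y - z)) = 0.
        by rewrite addrACA -opprD phiD ?HN ?HD // phiN ?HD // h subrr.
      have yzH : y - z \in H by rewrite HD ?HN.
      rewrite phiD // => h2.
      suff : phi (y - z) = 0.
        by rewrite phiD ?HN // phiN // => /eqP; rewrite subr_eq0 => /eqP.
      rewrite -[y - z]half_add // phiD ?Hhalf // /half !phiMn // -mulrnDl h2.
      by rewrite mul0rn.
    constructor 3; exists y; first by rewrite inE yH e'.
    rewrite /third /B /t e' addrA yy.
    by rewrite subrK opprK.
suff TS : triple_system (mem W) B.
  have [ts u E] := triple_system_sixsets TS; exists ts => // x.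
  by rewrite E cov.
split.
- by move=> x /WP[xH xV]; rewrite inE HN // phiN // VN.
- move=> x /WP[xH xV]; rewrite /B /t phiN // bN // opprK opprD -sN opprB.
  by rewrite [- b _ + _]addrC.
- move=> x y xW yW e; have := congr1 phi e; rewrite !phiB // => /bI.
  have [_ xV] := WP _ xW; have [_ yV] := WP _ yW => /(_ xV yV) e'.
  by move: e; rewrite /B /t e' => /addIr.
- move=> x y xW yW e; have := congr1 phi e; rewrite !phiC // => /cI.
  have [_ xV] := WP _ xW; have [_ yV] := WP _ yW => /(_ xV yV) e'.
  by move: e; rewrite /third /B /t e' => /oppr_inj; rewrite !addrA => /addIr /(double_inj oddU).
- by case/cov=> _; rewrite phi0.
- move=> x y xW yW; apply/eqP=> /(congr1 phi); rewrite phiB //; apply/eqP.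
  by apply: b12; [case/WP: xW | case/WP: yW].
- move=> x y xW yW; apply/eqP=> /(congr1 phi); rewrite phiC //; apply/eqP.
  by apply: b13; [case/WP: xW | case/WP: yW].
- move=> x y xW yW; apply/eqP=> /(congr1 phi); rewrite phiC // phiB //; apply/eqP.
  by apply: b23; [case/WP: xW | case/WP: yW].
Qed.

End TripleSystems.

(** * Triple systems on the planes F_p x F_p *)

Section PrimePlane.
Local Open Scope ring_scope.

(** The 8 nonzero vectors cannot be cut into triples, so the line of first coordinate 0 is left out.
    The other six vectors form the zero-sum triple (1, 0), (1, 1), (1, -1) and its negative. *)
Lemma triple_system_F3 : exists (V : {pred 'F_3 * 'F_3}) b,
  triple_system V b /\ forall v, covered V b v <-> v.1 != 0.
Proof.
have F3 (x : 'F_3) : [|| x == 0, x == 1 | x == - 1] by case: x => [[|[|[|]]]].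
pose V := [pred v : 'F_3 * 'F_3 | (v.1 != 0) && (v.2 == 0)].
pose b := fun v : 'F_3 * 'F_3 => (v.1, v.1).
have VP v : v \in V -> v = (1, 0) \/ v = (- 1, 0).
  rewrite inE; case: v => x y /= /andP[h /eqP ->]; move: (F3 x).
  by rewrite (negbTE h) /= => /orP[] /eqP ->; [left | right].
have cov v : covered V b v <-> v.1 != 0.
  split=> [[/andP[]//|[w /VP[]-> ->]|[w /VP[]-> ->]] //|].
  have V1 : (1, 0) \in V by rewrite inE.
  have V2 : (-1, 0) \in V by rewrite inE.
  case: v => x y /= x0.
  have := F3 x; rewrite (negbTE x0) /=; have := F3 y.
  move=> /or3P[] /eqP -> /orP[] /eqP ->.
  - by constructor 1.
  - by constructor 1.
  - by constructor 2; exists (1, 0).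
  - by constructor 3; exists (-1, 0) => //; apply/eqP.
  - by constructor 3; exists (1, 0) => //; apply/eqP.
  - by constructor 2; exists (-1, 0).
exists (pred_of_simpl V), b.
split=> //; split.
- by move=> v /VP[] ->; rewrite inE.
- by move=> v /VP[] ->; apply/eqP.
- by move=> v w /VP[] -> /VP[] -> // /eqP.
- by move=> v w /VP[] -> /VP[] -> // /eqP.
- by rewrite cov.
- by move=> v w /VP[] -> /VP[] ->.
- by move=> v w /VP[] -> /VP[] ->.
- by move=> v w /VP[] -> /VP[] ->.
Qed.

Section AbsFp.
Variable p : nat.

(** The distance from x to 0 on the cycle of residues. *)
Definition absp (x : 'F_p) : nat := minn (x : nat) ((- x)%R : nat).

Lemma abspN x : absp (- x) = absp x.
Proof. by rewrite /absp opprK minnC. Qed.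

Lemma absp_eq x y : absp x = absp y -> x = y \/ x = - y.
Proof.
rewrite /absp /minn; case: ltnP => _; case: ltnP => _ /val_inj; auto.
- by move=> <-; rewrite opprK; right.
- by move/oppr_inj; left.
Qed.

End AbsFp.

(* A vector [(x, y)] stands for the zero-sum triple [(x, y, - (x + y))], on which
   the cyclic shift [b] satisfies [1 + b + b^2 = 0].  As [p <> 3], the absolute
   values of a nonzero triple are not all equal, so exactly one of its shifts has
   its maximal absolute value in first but not in last position. *)
Lemma triple_system_Fp p : prime p -> p != 3 ->
  exists (V : {pred 'F_p * 'F_p}) b,
  triple_system V b /\ forall v, covered V b v <-> v != 0.
Proof.
move=> pp p3; pose a := @absp p.
pose V := [pred v : 'F_p * 'F_p | (a v.2 <= a v.1)%N && (a (v.1 + v.2)%R < a v.1)%N].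
pose b := fun v : 'F_p * 'F_p => (v.2, - (v.1 + v.2)).
have a_opp x : a (- x) = a x by apply: abspN.
have th v : third b v = (- (v.1 + v.2), v.1).
  by rewrite /third /b; congr pair => /=; ring.
have VP v : v \in V -> (a v.2 <= a v.1)%N /\ (a (v.1 + v.2)%R < a v.1)%N.
  by rewrite inE => /andP.
have bP v : v \in V -> (a (b v).1 <= a ((b v).1 + (b v).2)%R)%N /\
    (a (b v).2 < a ((b v).1 + (b v).2)%R)%N.
  move/VP; rewrite /b /= a_opp.
  have -> : v.2 - (v.1 + v.2) = - v.1 by ring.
      by rewrite a_opp => -[].
have tP v : v \in V -> (a (third b v).1 < a (third b v).2)%N /\
    (a ((third b v).1 + (third b v).2)%R <= a (third b v).2)%N.
  move/VP; rewrite th /= a_opp.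
  have -> : - (v.1 + v.2) + v.1 = - v.2 by ring.
      by rewrite a_opp => -[].
have a0 : a 0 = 0%N by rewrite /a /absp oppr0.
have cov v : covered V b v <-> v != 0.
  split=> [|v0].
    have nz w : w != 0 -> b w != 0.
      apply: contraNneq => e; case: (w) (congr1 fst e) (congr1 snd e) => x y /= -> /eqP.
      by rewrite addr0 oppr_eq0 => /eqP ->.
    have nV w : w \in V -> w != 0.
      by apply: contraTneq => ->; rewrite inE /= a0 ltn0 andbF.
    case=> [h|[w /nV h ->]|[w /nV h ->]].
    - exact: nV.
    - exact: nz.
    - have -> : third b w = b (b w) by rewrite th /b /=; congr pair; ring.
      exact/nz/nz.
  pose x := a v.1; pose y := a v.2; pose z := a (v.1 + v.2)%R.
  (* Equal absolute values mean [v.2] and [v.1 + v.2] agree up to sign with [v.1] and [v.2]; every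
     choice of signs gives [v = 0] or 3 [v.2] = 0, and the latter forces [v = 0] as p is not 3. *)
  have neq : ~ (x = y /\ y = z).
    case=> /absp_eq e1 /absp_eq e2; case/eqP: v0.
    suff e : v.2 = 0.
      by rewrite [v]surjective_pairing e; case: e1 => ->; rewrite e ?oppr0.
    have z3 t : t *+ 3 = 0 :> 'F_p -> t = 0.
      move/eqP; rewrite -mulr_natr mulf_eq0 => /orP[/eqP//|].
      rewrite -(dvdn_pcharf (pchar_Fp pp)) dvdn_prime2 // => /eqP e.
      by rewrite e eqxx in p3.
    case: e2 => e2.
      have v1 : v.1 = 0 by apply: (addIr v.2); rewrite -e2 add0r.
      by case: e1; rewrite v1 => e; [rewrite -e | rewrite -[v.2]opprK -e oppr0].
    case: e1 => e1; move: e2; rewrite e1.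
      by move=> e2; apply: z3; rewrite !mulrS {1}e2 addr0; ring.
    by rewrite addNr oppr0.
  (* The three cases tell which cyclic shift of the triple of [v] lies in [V]; that shift is the
     witness below. *)
  have : [\/ (y <= x)%N /\ (z < x)%N, (x <= z)%N /\ (y < z)%N
           | (z <= y)%N /\ (x < y)%N].
    move: neq; clearbody x y z => neq.
    case: (ltngtP y x) => h1; case: (ltngtP z x) => h2; case: (ltngtP y z) => h3;
    by first [constructor 1; lia | constructor 2; lia | constructor 3; lia].
  case=> [[h1 h2]|[h1 h2]|[h1 h2]].
  - by constructor 1; rewrite inE h1.
  - constructor 2; exists (- (v.1 + v.2), v.1).
      rewrite inE /= a_opp h1.
      have -> : - (v.1 + v.2) + v.1 = - v.2 by ring.
      by rewrite a_opp.
    by rewrite /b /= [LHS]surjective_pairing; congr pair; ring.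
  - constructor 3; exists (v.2, - (v.1 + v.2)).
      rewrite inE /= a_opp h1.
      have -> : v.2 - (v.1 + v.2) = - v.1 by ring.
      by rewrite a_opp.
    by rewrite th /= [LHS]surjective_pairing; congr pair; ring.
exists (pred_of_simpl V), b; split=> //; split.
- by move=> v; rewrite !inE /= !a_opp -opprD a_opp.
- by move=> v _; rewrite /b /=; congr pair => /=; ring.
- move=> v w _ _ e; have /= e1 := congr1 fst e; have /oppr_inj e2 := congr1 snd e.
  rewrite [v]surjective_pairing [w]surjective_pairing e1.
  by move: e2; rewrite e1 => /addIr ->.
- move=> v w _ _; rewrite !th => e; have /= e2 := congr1 snd e.
  have /oppr_inj e1 := congr1 fst e.
  rewrite [v]surjective_pairing [w]surjective_pairing e2.
  by move: e1; rewrite e2 => /addrI ->.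
- by rewrite cov eqxx.
- move=> v w /bP h1 /VP h2; apply/eqP=> e; move: h1 h2; rewrite e.
  by move: (a _) (a _) (a _) => *; lia.
- move=> v w /tP h1 /VP h2; apply/eqP=> e; move: h1 h2; rewrite e.
  by move: (a _) (a _) (a _) => *; lia.
- move=> v w /tP h1 /bP h2; apply/eqP=> e; move: h1 h2; rewrite e.
  by move: (a _) (a _) (a _) => *; lia.
Qed.
End PrimePlane.

(** * Maps from noncyclic Abelian groups onto F_p x F_p *)

Section NonCyclic.
Local Open Scope group_scope.

(** An element a whose order is the exponent splits off: H = <a> x B with B nontrivial. With B' of
    prime index p in B, the subgroups are M1 = <a> B' and M2 = <a^p> B; a separates them on one
    side, an element of B outside M1 on the other. *)
Lemma noncyclic_prime_index (gT : finGroupType) (H : {group gT}) :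
  abelian H -> ~~ cyclic H ->
  exists p (M1 M2 : {group gT}),
    [/\ prime p, M1 <| H /\ #|H : M1| = p, M2 <| H /\ #|H : M2| = p,
        exists2 x, x \in M1 & x \in H :\: M2
      & exists2 x, x \in M2 & x \in H :\: M1].
Proof.
move=> abH ncH.
have [a aH oa] := exponent_witness (abelian_nil abH).
have /splitsP[B /complP[TIaB defH]] := abelian_splits aH (esym oa) abH.
have sBH : B \subset H by rewrite -defH mulG_subr.
have saH : <[a]> \subset H by rewrite cycle_subG.
have ntB : B :!=: 1.
  by apply: contra ncH => /eqP B1; rewrite -defH B1 mulg1 cycle_cyclic.
have abB := abelianS sBH abH.
have [B' nB' pB] := sol_prime_factor_exists (abelian_sol abB) ntB.
have sB'B := normal_sub nB'.
set p := #|B : B'| in pB; have cB : (#|B'| * p)%N = #|B| := Lagrange sB'B.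
(* By Cauchy B has an element of order p, so p divides the exponent of H, which is the order of a.
   Hence <a^p> has index p in <a>. *)
have p_a : p %| #[a].
  have [|x xB ox] := @Cauchy _ p B pB; first by rewrite -cB dvdn_mull.
  by rewrite -oa -ox dvdn_exponent // (subsetP sBH).
have cH : (#[a] * #|B|)%N = #|H| by rewrite -defH TI_cardMg.
have cAB (A C : {group gT}) : A \subset <[a]> -> C \subset B ->
    [/\ A <*> C \subset H, A <*> C <| H & #|A <*> C| = (#|A| * #|C|)%N].
  move=> sA sC; have sAH := subset_trans sA saH; have sCH := subset_trans sC sBH.
  have sJ : A <*> C \subset H by rewrite join_subG sAH.
  split=> //; first by rewrite -(sub_abelian_normal _ abH).
  rewrite cent_joinEr; last exact: subset_trans (subset_trans sCH abH) (centS sAH).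
  by rewrite TI_cardMg //; apply/trivgP; rewrite -TIaB setISS.
have [sM1 nM1 cM1] := cAB <[a]>%G B' (subxx _) sB'B.
have [sM2 nM2 cM2] := cAB <[a ^+ p]>%G B (cycleX _ _) (subxx _).
have p0 := prime_gt0 pB.
have iM1 : #|H : <[a]> <*> B'| = p.
  rewrite -divgS // cM1 -cH -cB mulnA mulKn //.
  by rewrite muln_gt0 cardG_gt0 order_gt0.
have iM2 : #|H : <[a ^+ p]> <*> B| = p.
  rewrite -divgS // cM2 -cH -[#|<[_]>%G|]/#[a ^+ p] orderXdiv // .
  rewrite -{1}(divnK p_a) -mulnA [(p * _)%N]mulnC mulnA mulKn //.
  by rewrite muln_gt0 cardG_gt0 andbT divn_gt0 // dvdn_leq.
have notH (M : {group gT}) : #|H : M| = p -> ~~ (H \subset M).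
  by move=> iM; rewrite -indexg_eq1 iM neq_ltn prime_gt1 ?orbT.
exists p, (<[a]> <*> B')%G, (<[a ^+ p]> <*> B)%G; split=> //.
- exists a; first by rewrite mem_gen // inE cycle_id.
  rewrite inE aH andbT; apply: contra (notH _ iM2) => aM.
  by rewrite -defH mul_subG ?cycle_subG ?joing_subr.
- have : ~~ (B \subset <[a]> <*> B').
    apply: contra (notH _ iM1) => sB.
    by rewrite -defH mul_subG ?joing_subl.
  case/subsetPn=> x xB xM; exists x; last by rewrite inE xM (subsetP sBH).
  by rewrite mem_gen // inE xB orbT.
Qed.

End NonCyclic.

Section Decomposition.
Local Open Scope ring_scope.
Variable U : finZmodType.

(** The quotient [H / M] is cyclic of order p, and [chi] is the discrete logarithm there with
    respect to a generator. *)
Lemma prime_index_character (H M : {group U}) p :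
  prime p -> (M <| H)%g -> #|H : M|%g = p ->
  exists2 chi : U -> 'F_p, {in H &, {morph chi : x y / x + y}}
    & forall x, x \in H -> (chi x == 0) = (x \in M).
Proof.
move=> pp nM iM; have cQ : #|H / M|%g = p by rewrite card_quotient ?normal_norm.
have /cyclicP[z Hz] : cyclic (H / M)%g by rewrite prime_cyclic ?cQ.
have oz : #[z]%g = p by rewrite /order -Hz.
pose k (x : U) := if [pick i : 'I_p | coset M x == (z ^+ i)%g] is Some i
                  then nat_of_ord i else 0%N.
have kE x : x \in H -> coset M x = (z ^+ k x)%g.
  move=> xH; have : coset M x \in <[z]>%g by rewrite -Hz mem_quotient.
  case/cyclePmin=> i; rewrite oz => ip e; rewrite /k.
  by case: pickP => [j /eqP //|/(_ (Ordinal ip))]; rewrite /= e eqxx.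
exists (fun x => (k x)%:R).
  move=> x y xH yH; rewrite -natrD.
  have xyH : x + y \in H by rewrite -zmodMgE groupM.
  rewrite -(Fp_nat_mod pp (k (x + y))) -(Fp_nat_mod pp (k x + k y)).
  congr (_%:R); apply/eqP; rewrite -oz -eq_expg_mod_order expgD -!kE //.
  by rewrite -zmodMgE morphM // (subsetP (normal_norm nM)).
move=> x xH; rewrite -(dvdn_pcharf (pchar_Fp pp)) -oz order_dvdn -kE //.
have xN : x \in ('N(M))%g by rewrite (subsetP (normal_norm nM)).
by apply/eqP/idP => [|xM]; [apply: coset_idr | apply: coset_id].
Qed.

(** The characters with kernels [M1] and [M2] are paired. On [e] and [d], each lying in just one of
    the kernels, the pair is diagonal with nonzero entries, which gives surjectivity. *)
Lemma noncyclic_plane (H : {group U}) : ~~ cyclic H ->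
  exists2 p, prime p & exists2 phi : U -> 'F_p * 'F_p,
    {in H &, {morph phi : x y / x + y}} & forall v, exists2 x, x \in H & phi x = v.
Proof.
move=> ncH; have abH : abelian H by apply: abelianS (subsetT _) (zmod_abelian _).
have [p [M1 [M2 [pp [n1 i1] [n2 i2] [d dM1 dM2] [e eM2 eM1]]]]] :=
  noncyclic_prime_index abH ncH.
have [f1 f1D f1E] := prime_index_character pp n1 i1.
have [f2 f2D f2E] := prime_index_character pp n2 i2.
move: dM2 eM1; rewrite !inE => /andP[dM2 dH] /andP[eM1 eH].
exists p => //; exists (fun x => (f1 x, f2 x)).
  by move=> x y xH yH; rewrite f1D // f2D.
have HX (x : U) k : x \in H -> x *+ k \in H by rewrite -zmodXgE; apply: groupX.
have fX (f : U -> 'F_p) k x : {in H &, {morph f : x y / x + y}} -> x \in H ->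
    f (x *+ k) = f x *+ k.
  move=> fD xH; have f0 : f 0 = 0.
    have H0 : 0 \in H by rewrite -zmod1gE group1.
    by apply: (addIr (f 0)); rewrite -fD // !add0r.
  elim: k => [|k IH]; first by rewrite !mulr0n.
  by rewrite !mulrSr fD ?IH ?HX.
have f1d : f1 d = 0 by apply/eqP; rewrite f1E.
have f2e : f2 e = 0 by apply/eqP; rewrite f2E.
have f2d : f2 d != 0 by rewrite f2E.
have f1e : f1 e != 0 by rewrite f1E.
move=> [u v]; exists (e *+ (u / f1 e)%R + d *+ (v / f2 d)%R).
  by rewrite -zmodMgE groupM // HX.
rewrite f1D ?HX // f2D ?HX // !fX // f1d f2e !mul0rn addr0 add0r.
by rewrite -[f1 e *+ _]mulr_natr -[f2 d *+ _]mulr_natr !natr_Zp; congr pair; rewrite mulrC divfK.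
Qed.

(** * Packing six-sets into groups of odd order *)

Hypothesis oddU : odd #|U|.

(* The integer triples of [skolem_triples] miss up to 7 elements of a cyclic group;
   since [6 l + 3 <= N <= 6 s + 7] implies [l <= s], this loss is harmless. *)
Definition packed (H : {group U}) : Prop := exists ts : seq (U * U),
   [/\ uniq (sixsets ts), all (fun x => (x != 0) && (x \in H)) (sixsets ts)
     & (#|H| <= 6 * size ts + 7)%N].

(** The six-sets fill [H :\: M] exactly, so the number of elements missed in [H] is the number
    missed in [M]. *)
Lemma packed_extend (H M : {group U}) (ts : seq (U * U)) :
  M \subset H -> uniq (sixsets ts) ->
  (forall x, x \in sixsets ts <-> x \in H :\: M) -> packed M -> packed H.
Proof.
move=> sMH u1 E1 [ts2 [u2 a2 c2]]; exists (ts ++ ts2).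
have M0 : 0 \in M by rewrite -zmod1gE group1.
have E x : (x \in sixsets ts) = (x \in H :\: M) by apply/idP/idP=> /E1.
rewrite sixsets_cat cat_uniq u1 u2 /= andbT; split.
- apply/hasPn=> x /(allP a2) /andP[_ xM]; apply/negP => /E1.
  by rewrite inE xM.
- rewrite all_cat; apply/andP; split; apply/allP=> x.
    rewrite E inE => /andP[xM ->]; rewrite andbT.
    by apply: contraNneq xM => ->.
  by case/(allP a2)/andP=> -> /(subsetP sMH) ->.
- have : #|H :\: M| = (6 * size ts)%N.
    by rewrite -size_sixsets -(card_uniqP u1); apply: eq_card => x; rewrite E.
  have := cardsID M H; rewrite (setIidPr sMH) size_cat.
  move: c2; move: (#|M| : nat) (#|H| : nat) (#|H :\: M| : nat) => *; lia.
Qed.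

Lemma kernel_group_set (H : {group U}) (K : zmodType) (f : U -> K) :
  {in H &, {morph f : x y / x + y}} -> group_set [set x in H | f x == 0].
Proof.
move=> fD; have H0 : 0 \in H by rewrite -zmod1gE group1.
have f0 : f 0 = 0 by apply: (addIr (f 0)); rewrite -fD // !add0r.
apply/group_setP; split; first by rewrite inE zmod1gE H0 f0 eqxx.
move=> x y; rewrite !inE zmodMgE => /andP[xH /eqP fx] /andP[yH /eqP fy].
by rewrite -{1}zmodMgE groupM // fD // fx fy addr0 eqxx.
Qed.

(** The recursion step, with M the kernel of [pr \o phi]. The map [pr] is the identity when the
    triples cover all nonzero vectors; for p = 3 it is the first projection, whose kernel is the
    omitted line. *)
Lemma packed_kernel (H : {group U}) (K L : zmodType) (phi : U -> K)
    (pr : K -> L) V b :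
  {in H &, {morph phi : x y / x + y}} ->
  (forall v, exists2 x, x \in H & phi x = v) ->
  {morph pr : x y / x + y} -> (exists v, pr v != 0) ->
  triple_system V b -> (forall v, covered V b v <-> pr v != 0) ->
  (forall M : {group U}, (#|M| < #|H|)%N -> packed M) -> packed H.
Proof.
move=> phiD phi_onto prD [v pv] VS cov IH.
have fD : {in H &, {morph pr \o phi : x y / x + y}}.
  by move=> x y xH yH; rewrite /= phiD // prD.
pose M := Group (kernel_group_set fD).
have ME x : (x \in M) = (x \in H) && (pr (phi x) == 0) by rewrite inE.
have sMH : M \subset H by apply/subsetP=> x; rewrite ME => /andP[].
have [ts u E] := lift_sixsets oddU phiD phi_onto VS.
apply: (packed_extend sMH u).
  move=> x; rewrite E cov inE ME negb_and; case: (x \in H) => /=.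
    by rewrite andbT; split=> [[]|].
  by split=> // [[]].
apply: IH; apply: proper_card; apply/properP; split=> //.
have [x xH xv] := phi_onto v; exists x => //.
by rewrite ME xH xv (negbTE pv).
Qed.

Lemma subgroup_packed (H : {group U}) : packed H.
Proof.
have [n] := ubnP #|H|; elim: n H => // n IH H; rewrite ltnS => Hn.
have IH' (M : {group U}) : (#|M| < #|H|)%N -> packed M.
  by move=> hM; apply: IH; apply: leq_trans hM Hn.
have [cH|ncH] := boolP (cyclic H); first exact: cyclic_sixsets.
have [p pp [phi phiD phi_onto]] := noncyclic_plane ncH.
have [p3|p3] := eqVneq p 3.
  move: phi phiD phi_onto; rewrite p3 => phi phiD phi_onto.
  have [V [b [VS cov]]] := triple_system_F3.
  apply: (packed_kernel (pr := fst) phiD phi_onto _ _ VS cov IH') => //.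
  by exists (1, 0).
have [V [b [VS cov]]] := triple_system_Fp pp p3.
apply: (packed_kernel (pr := id) phiD phi_onto _ _ VS cov IH') => //.
exists (1, 0); apply/eqP=> /(congr1 fst) /= /eqP.
by rewrite oner_eq0.
Qed.

(** Only [l] six-sets of a packing are kept. The remaining nonzero elements, those of discarded
    six-sets included, are closed under negation and are split into pairs by [half_list]. *)
Lemma sixsets_and_pairs (l : nat) : (6 * l + 3 <= #|U|)%N ->
  exists (ts : seq (U * U)) (qs : seq U), [/\ size ts = l, (6 * l + 2 * size qs + 1 = #|U|)%N
    & uniq ((0 : U) :: sixsets ts ++ qs ++ map -%R qs)].
Proof.
move=> hl; have [ts0 [u0 a0 c0]] := subgroup_packed [set: U]%G.
pose ts := take l ts0.
have szt : size ts = l.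
  by rewrite size_takel //; move: c0; rewrite cardsT => c0; have := leq_trans hl c0; lia.
have E0 : sixsets ts0 = sixsets ts ++ sixsets (drop l ts0).
  by rewrite -sixsets_cat cat_take_drop.
have u1 : uniq (sixsets ts) by move: u0; rewrite E0 cat_uniq => /andP[].
have n0 : 0 \notin sixsets ts.
  apply/negP=> h; have /(allP a0) : 0 \in sixsets ts0 by rewrite E0 mem_cat h.
  by rewrite eqxx.
have sN x : x \in sixsets ts -> - x \in sixsets ts.
  case/flatten_mapP=> t tt; rewrite !inE => h; apply/flatten_mapP; exists t => //.
  rewrite !inE; case/or4P: h => [||| /or3P[]] /eqP ->;
  by rewrite ?opprK ?eqxx ?orbT.
pose Q := [set x | (x != 0) && (x \notin sixsets ts)].
have [|x|qs Eq] := @half_list _ oddU Q; first by rewrite inE eqxx.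
  rewrite !inE oppr_eq0 => /andP[-> /=]; apply: contra => /sN.
  by rewrite opprK.
exists ts, qs.
have mQ x : (x \in qs ++ map -%R qs) = (x \in Q) by rewrite (perm_mem Eq) mem_enum.
have uQ : uniq (qs ++ map -%R qs) by rewrite (perm_uniq Eq) enum_uniq.
have uu : uniq (0 :: sixsets ts ++ qs ++ map -%R qs).
  rewrite /= mem_cat negb_or n0 mQ inE eqxx /= cat_uniq u1 uQ andbT /=.
  by apply/hasPn=> x; rewrite mQ inE => /andP[].
split=> //.
have all_in : 0 :: sixsets ts ++ qs ++ map -%R qs =i U.
  move=> x; rewrite in_cons mem_cat mQ inE [RHS]inE.
  by case: (x == 0); case: (x \in sixsets ts).
rewrite -(eq_card all_in) (card_uniqP uu) /= !size_cat size_map size_sixsets szt; lia.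
Qed.

End Decomposition.

(** * Walks and their parity *)

Section Walks.
Variable G : sgraph.
Implicit Types (u v x y : G) (p q : bool).

(* Adjacency in the bipartite double cover: the Boolean records the parity of a
   walk. *)
Definition cover_adj : rel (G * bool) :=
  fun x y : G * bool => adj x.1 y.1 && (x.2 != y.2).

Definition even_walk u v := connect cover_adj (u, false) (v, false).
Definition odd_walk u v := connect cover_adj (u, false) (v, true).

Lemma cover_connect_sym : connect_sym cover_adj.
Proof.
by apply: sym_connect_sym => x y; rewrite /cover_adj adj_sym [x.2 == _]eq_sym.
Qed.

(** Exchanging the two sheets is an automorphism of the double cover. *)
Lemma cover_connect_flip u v p q :
  connect cover_adj (u, p) (v, q) = connect cover_adj (u, ~~ p) (v, ~~ q).
Proof.
suff H a b c d : connect cover_adj (a, c) (b, d) -> connect cover_adj (a, ~~ c) (b, ~~ d).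
  by apply/idP/idP=> /H; rewrite ?negbK.
case/connectP=> s; elim: s a c => [|[e f] s IH] a c /=.
  by move=> _ [-> ->]; apply: connect0.
case/andP=> /andP[/= h1 h2] /IH H /H; apply: connect_trans.
by apply: connect1; rewrite /cover_adj /= h1; case: (c) (f) h2 => [] [].
Qed.

Lemma cover_connect_parity u v p q :
  connect cover_adj (u, p) (v, q) = if p == q then even_walk u v else odd_walk u v.
Proof. by case: p q => [] [] //=; rewrite cover_connect_flip. Qed.

Lemma even_walk_refl u : even_walk u u. Proof. exact: connect0. Qed.

Lemma even_walk_sym u v : even_walk u v = even_walk v u.
Proof. exact: cover_connect_sym. Qed.

Lemma odd_walk_sym u v : odd_walk u v = odd_walk v u.
Proof. by rewrite {1}/odd_walk cover_connect_sym cover_connect_parity. Qed.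

Lemma even_walk_trans u v w : even_walk u v -> even_walk v w -> even_walk u w.
Proof. exact: connect_trans. Qed.

Lemma even_odd_walk u v w : even_walk u v -> odd_walk v w -> odd_walk u w.
Proof. exact: connect_trans. Qed.

Lemma odd_even_walk u v w : odd_walk u v -> even_walk v w -> odd_walk u w.
Proof. by rewrite !(odd_walk_sym u) even_walk_sym => h /even_odd_walk; apply. Qed.

Lemma odd_odd_walk u v w : odd_walk u v -> odd_walk v w -> even_walk u w.
Proof.
move=> h1 h2; apply: (connect_trans h1).
by rewrite cover_connect_parity.
Qed.

Lemma adj_odd_walk u v : adj u v -> odd_walk u v.
Proof. by move=> h; apply: connect1; rewrite /cover_adj /= h. Qed.

Lemma connect_walk u v : connect (@adj G) u v = even_walk u v || odd_walk u v.
Proof.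
apply/idP/orP.
  case/connectP=> s; elim: s u => [|e s IH] u /=.
    by move=> _ ->; left; apply: even_walk_refl.
  case/andP=> /adj_odd_walk h /IH H /H [] h'.
    by right; apply: odd_even_walk h h'.
  by left; apply: odd_odd_walk h h'.
suff H (x y : G * bool) : connect cover_adj x y -> connect (@adj G) x.1 y.1 by case=> /H.
case/connectP=> s; elim: s x => [|e s IH] x /=; first by move=> _ ->.
by case/andP=> /andP[/connect1 h _] /IH H /H; apply: connect_trans.
Qed.

End Walks.

(** * Weight functions realized by edge labelings *)

Section Realizable.
Local Open Scope ring_scope.
Variables (G : sgraph) (U : finZmodType).
Implicit Types (u v x y : G) (w : G -> U).

Definition realizable w : Prop := exists f : {set G} -> U, weight f =1 w.

Lemma realizable_ext w1 w2 : w1 =1 w2 -> realizable w1 -> realizable w2.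
Proof. by move=> e [f fE]; exists f => x; rewrite fE. Qed.

Lemma realizable0 : realizable (fun=> 0).
Proof. by exists (fun=> 0) => x; rewrite /weight big1. Qed.

Lemma realizableD w1 w2 :
  realizable w1 -> realizable w2 -> realizable (fun x => w1 x + w2 x).
Proof.
move=> [f1 E1] [f2 E2]; exists (fun A => f1 A + f2 A) => x.
by rewrite /weight big_split /= -E1 -E2.
Qed.

Definition delta u (a : U) : G -> U := fun x => if x == u then a else 0.

Lemma deltaD u a b x : delta u (a + b) x = delta u a x + delta u b x.
Proof. by rewrite /delta; case: eqP => _; rewrite ?addr0. Qed.

Lemma deltaN u a x : delta u (- a) x = - delta u a x.
Proof. by rewrite /delta; case: eqP => _; rewrite ?oppr0. Qed.

Lemma realizable_edge u v a : adj u v ->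
  realizable (fun x => delta u a x + delta v a x).
Proof.
move=> uv; have nuv : u != v by apply: contraTneq uv => ->; rewrite adj_irrefl.
have set2E x y : ([set x; y] == [set u; v]) = ((x == u) && (y == v)) || ((x == v) && (y == u)).
  apply/eqP/orP=> [e|[]/andP[/eqP-> /eqP->] //]; last by rewrite setUC.
  have hx : x \in [set u; v] by rewrite -e !inE eqxx.
  have hy : y \in [set u; v] by rewrite -e !inE eqxx orbT.
  have hu : u \in [set x; y] by rewrite e !inE eqxx.
  have hv : v \in [set x; y] by rewrite e !inE eqxx orbT.
  move: hx hy hu hv; rewrite !inE => /orP[] /eqP -> /orP[] /eqP ->;
  rewrite ?eqxx ?orbb; auto.
    by rewrite eq_sym (negbTE nuv).
  by rewrite (negbTE nuv).
exists (fun A => if A == [set u; v] then a else 0) => x; rewrite /weight -big_mkcondr /=.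
under eq_bigl => y do rewrite set2E.
rewrite /delta; case: (x =P u) => [->|/eqP xu].
  rewrite (negbTE nuv) addr0 (big_pred1 v) // => y /=.
  by case: (y =P v) => [->|]; rewrite ?uv ?orbF ?andbF.
case: (x =P v) => [->|/eqP xv].
  rewrite add0r (big_pred1 u) // => y /=.
  by case: (y =P u) => [->|]; rewrite ?andbF //= adj_sym uv.
by rewrite big_pred0 ?addr0 // => y; rewrite /= !andbF.
Qed.

Definition signed (p : bool) (a : U) := if p then - a else a.

(** The sheet gives the sign of the label. It changes at every step, so the contributions at inner
    vertices cancel and the sum telescopes. *)
Lemma realizable_walk (x y : G * bool) a : connect (@cover_adj G) x y ->
  realizable (fun z => delta x.1 (signed x.2 a) z - delta y.1 (signed y.2 a) z).
Proof.
case/connectP=> s; elim: s x => [|e s IH] x /=.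
  by move=> _ ->; apply: realizable_ext realizable0 => z; rewrite subrr.
case/andP=> /andP[h1 h2] /IH H /H{H} H.
apply: realizable_ext (realizableD (realizable_edge (signed x.2 a) h1) H) => z /=.
have -> : signed x.2 a = - signed e.2 a.
  by case: (x.2) (e.2) h2 => [] []; rewrite /= ?opprK.
by rewrite !deltaN addrA subrK.
Qed.

Lemma realizable_even u v a : even_walk u v ->
  realizable (fun x => delta u a x - delta v a x).
Proof. exact: (@realizable_walk (u, false) (v, false)). Qed.

Lemma realizable_odd u v a : odd_walk u v ->
  realizable (fun x => delta u a x + delta v a x).
Proof.
move=> h; apply: realizable_ext (@realizable_walk (u, false) (v, true) a h) => x /=.
by rewrite deltaN opprK.
Qed.

(** A sum instead of a lookup, so that concatenating lists adds the weight functions; for distinct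
    vertices the two readings agree. *)
Definition assigned (s : seq (G * U)) : G -> U :=
  fun x => \sum_(t <- s) delta t.1 t.2 x.

Lemma realizable_cat s1 s2 : realizable (assigned s1) ->
  realizable (assigned s2) -> realizable (assigned (s1 ++ s2)).
Proof.
by move=> h1 h2; apply: realizable_ext (realizableD h1 h2) => x; rewrite /assigned big_cat.
Qed.

Lemma assigned_mem s u a : uniq (unzip1 s) -> (u, a) \in s -> assigned s u = a.
Proof.
rewrite /assigned; elim: s => //= -[v b] s IH /andP[/= vs us].
rewrite inE big_cons /= => /orP[/eqP[-> ->]|h].
  rewrite /delta eqxx big_seq big1 ?addr0 // => t ts; case: eqP => // e.
  by case/negP: vs; rewrite e; apply: map_f.
rewrite IH // /delta; case: eqP => [e|_]; last by rewrite add0r.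
by case/negP: vs; rewrite -e; apply/mapP; exists (u, a).
Qed.

End Realizable.

(** * Splitting the vertex set into pairs and triples *)

Section Gadgets.
Variable T : Type.
Definition flat2 (s : seq (T * T)) : seq T := flatten [seq [:: t.1; t.2] | t <- s].
Definition seq3 (t : T * T * T) : seq T := [:: t.1.1; t.1.2; t.2].
Definition flat3 (s : seq (T * T * T)) : seq T := flatten (map seq3 s).

Lemma size_flat2 s : size (flat2 s) = 2 * size s.
Proof. by elim: s => //= t s; rewrite -/(flat2 s) => ->; lia. Qed.

Lemma size_flat3 s : size (flat3 s) = 3 * size s.
Proof. by elim: s => //= t s; rewrite -/(flat3 s) => ->; lia. Qed.

Lemma flat2_cat s1 s2 : flat2 (s1 ++ s2) = flat2 s1 ++ flat2 s2.
Proof. by rewrite /flat2 map_cat flatten_cat. Qed.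

Lemma flat3_cat s1 s2 : flat3 (s1 ++ s2) = flat3 s1 ++ flat3 s2.
Proof. by rewrite /flat3 map_cat flatten_cat. Qed.
End Gadgets.

Section Decompose.
Variable G : sgraph.
Implicit Types (s : seq G) (u v x y : G).

Definition even_pair (t : G * G) := even_walk t.1 t.2.
Definition even_triple (t : G * G * G) := even_walk t.1.1 t.1.2 && even_walk t.1.1 t.2.
Definition odd_triple (t : G * G * G) := odd_walk t.1.1 t.1.2 && odd_walk t.1.1 t.2.

(** [Ss] is destined for weights (a + b, a, b), [Zs] for zero-sum weights and [Ps] for opposite
    weights. *)
Definition decomposable s : Prop := exists Ss Zs Ps,
  [/\ all odd_triple Ss, all even_triple Zs, all even_pair Ps
    & perm_eq (flat3 Ss ++ flat3 Zs ++ flat2 Ps) s].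

Lemma decomposable_perm s1 s2 : perm_eq s1 s2 -> decomposable s1 -> decomposable s2.
Proof.
move=> p [Ss [Zs [Ps [h1 h2 h3 h4]]]]; exists Ss, Zs, Ps; split=> //.
exact: perm_trans h4 p.
Qed.

Lemma decomposable_cat s1 s2 :
  decomposable s1 -> decomposable s2 -> decomposable (s1 ++ s2).
Proof.
move=> [Ss [Zs [Ps [h1 h2 h3 h4]]]] [Ss' [Zs' [Ps' [h1' h2' h3' h4']]]].
exists (Ss ++ Ss'), (Zs ++ Zs'), (Ps ++ Ps').
rewrite !all_cat h1 h2 h3 h1' h2' h3'; split=> //.
rewrite !flat3_cat flat2_cat.
apply: perm_trans (perm_cat h4 h4').
by apply/seq.permP=> q; rewrite !count_cat; lia.
Qed.

Lemma decomposable_pair u v : even_walk u v -> decomposable [:: u; v].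
Proof. by move=> h; exists [::], [::], [:: (u, v)]; rewrite /= /even_pair h. Qed.

Lemma decomposable_odd_triple u v w :
  odd_walk u v -> odd_walk u w -> decomposable [:: u; v; w].
Proof.
by move=> h1 h2; exists [:: (u, v, w)], [::], [::]; rewrite /= /odd_triple h1 h2.
Qed.

Lemma decomposable_even_triple u v w :
  even_walk u v -> even_walk u w -> decomposable [:: u; v; w].
Proof.
by move=> h1 h2; exists [::], [:: (u, v, w)], [::]; rewrite /= /even_triple h1 h2.
Qed.

Lemma decomposable_even s : {in s &, forall u v, even_walk u v} ->
  ~~ odd (size s) -> decomposable s.
Proof.
have [n] := ubnP (size s); elim: n s => // n IH [|u [|v s]] //= hn hs.
  by move=> _; exists [::], [::], [::].
rewrite negbK => os; apply: (@decomposable_cat [:: u; v] s).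
  by apply: decomposable_pair; apply: hs; rewrite !inE eqxx ?orbT.
apply: IH => //; first by lia.
by move=> x y hx hy; apply: hs; rewrite !inE ?hx ?hy !orbT.
Qed.

(* Excludes (up to the order of the classes) the class sizes (1, 1) and (1, 3)
   of K_2 and K_{1,3}, as well as (odd, 0). *)
Definition good_sizes a b :=
  if odd a && odd b then [|| (2 < a) && (2 < b), (a == 1) && (4 < b) | (b == 1) && (4 < a)]
  else if odd a then 0 < b else if odd b then 0 < a else true.

Lemma decomposable_classes sx sy :
  {in sx &, forall u v, even_walk u v} -> {in sy &, forall u v, even_walk u v} ->
  {in sx & sy, forall u v, odd_walk u v} -> good_sizes (size sx) (size sy) ->
  decomposable (sx ++ sy).
Proof.
(* Two even classes need pairs only; otherwise, by symmetry, the first class is taken to be odd. *)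
suff H a b : {in a &, forall u v, even_walk u v} -> {in b &, forall u v, even_walk u v} ->
    {in a & b, forall u v, odd_walk u v} ->
    odd (size a) -> (~~ odd (size b) && (0 < size b)) ||
      odd (size b) && ((2 < size a) && (2 < size b) || (size a == 1) && (4 < size b)) ->
    decomposable (a ++ b).
  move=> hx hy hxy; rewrite /good_sizes.
  have hyx : {in sy & sx, forall u v, odd_walk u v}.
    by move=> u v hu hv; rewrite odd_walk_sym hxy.
  have swap : decomposable (sy ++ sx) -> decomposable (sx ++ sy).
    by apply: decomposable_perm; rewrite perm_catC.
  case ox: (odd (size sx)); case oy: (odd (size sy)) => /=.
  - case/or3P=> h; [apply: H | apply: H | apply/swap/H] => //;
    by rewrite ?ox ?oy ?h ?orbT.
  - by move=> h; apply: H; rewrite // oy h.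
  - by move=> h; apply/swap/H; rewrite // ox h.
  - by move=> _; apply: decomposable_cat; apply: decomposable_even; rewrite ?ox ?oy.
move=> ha hb hab oa.
case: a ha hab oa => // u a ha hab /= oa.
have sub (s1 s2 : seq G) : {subset s1 <= s2} -> {in s2 &, forall u v, even_walk u v} ->
    {in s1 &, forall u v, even_walk u v}.
  by move=> ss h x y /ss hx /ss hy; apply: h.
case/orP=> [/andP[ob b0]|/andP[ob /orP[]/andP[]]].
(* Odd against even: one odd triple with its first vertex in the odd class leaves two even
   classes. *)
- case: b hb hab ob b0 => // v [//|v' b] hb hab /= ob _.
  apply: (@decomposable_perm ([:: u; v; v'] ++ a ++ b)).
    by apply/seq.permP=> q; rewrite /= !count_cat /=; lia.
  apply: decomposable_cat.
    by apply: decomposable_odd_triple; apply: hab; rewrite !inE eqxx ?orbT.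
  apply: decomposable_cat; apply: decomposable_even => //.
  + by apply: sub ha => z hz; rewrite !inE hz ?orbT.
  + by apply: sub hb => z hz; rewrite !inE hz ?orbT.
  + by rewrite negbK in ob.
(* Both odd and at least 3: two odd triples, headed in different classes, take three vertices from
   each class. *)
- case: a ha hab oa => [|x1 [//|x2 a]] // ha hab /= oa _.
  case: b hb hab ob => [|y1 [//|y2 [//|v b]]] // hb hab /= ob _.
  apply: (@decomposable_perm ([:: u; y1; y2] ++ [:: v; x1; x2] ++ a ++ b)).
    by apply/seq.permP=> q; rewrite /= !count_cat /=; lia.
  apply: decomposable_cat.
    by apply: decomposable_odd_triple; apply: hab; rewrite !inE eqxx ?orbT.
  apply: decomposable_cat.
    by apply: decomposable_odd_triple; rewrite odd_walk_sym; apply: hab; rewrite !inE eqxx ?orbT.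
  apply: decomposable_cat; apply: decomposable_even.
  + by apply: sub ha => z hz; rewrite !inE hz ?orbT.
  + by move: oa; rewrite !negbK.
  + by apply: sub hb => z hz; rewrite !inE hz ?orbT.
  + by move: ob; rewrite !negbK.
(* Sizes 1 and at least 5: an odd triple uses up the single vertex, and an even triple restores the
   parity of the other class. *)
- case: a ha hab oa => // ha hab _ _.
  case: b hb hab ob => [|v [//|v' [//|z1 [//|z2 [//|z3 b]]]]] // hb hab /= ob _.
  apply: (@decomposable_perm ([:: u; v; v'] ++ [:: z1; z2; z3] ++ b)).
    by apply/seq.permP=> q; rewrite /= ?count_cat /=; lia.
  apply: decomposable_cat.
    by apply: decomposable_odd_triple; apply: hab; rewrite !inE eqxx ?orbT.
  apply: decomposable_cat.
    by apply: decomposable_even_triple; apply: hb; rewrite !inE eqxx ?orbT.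
  apply: decomposable_even; last by move: ob; rewrite !negbK.
  by apply: sub hb => z hz; rewrite !inE hz ?orbT.
Qed.

Lemma star_iso (C : {set G}) (c : G) r : c \in C -> #|C| = r.+1 ->
  {in C &, forall x y, adj x y = ((x == c) != (y == c))} ->
  isomorphic (induced C) (star r).
Proof.
move=> cC cardC adjC.
have cD : #|C :\ c| = r by have := cardsD1 c C; rewrite cC cardC; lia.
pose h (x : induced C) : star r :=
  if val x == c then None else insub (index (val x) (enum (C :\ c))).
have hS (x : induced C) : val x != c ->
    exists2 i : 'I_r, h x = Some i & nat_of_ord i = index (val x) (enum (C :\ c)).
  move=> xc; rewrite /h (negbTE xc).
  have lt : index (val x) (enum (C :\ c)) < r.
    by rewrite -cD cardE index_mem mem_enum !inE xc (valP x).
  by rewrite insubT; exists (Ordinal lt).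
have hN (x : induced C) : (h x == None) = (val x == c).
  by case: (eqVneq (val x) c) => [e|/hS[i -> _]]; rewrite // /h e !eqxx.
exists h; last by move=> x y; rewrite /= /star_adj !hN -adjC ?(valP x) ?(valP y).
apply: inj_card_bij.
  move=> x y e; have := hN x; rewrite e hN; case: (eqVneq (val x) c) => [xc|xc] yc.
    by apply: val_inj; rewrite /= xc; apply/esym/eqP.
  have [i hx ix] := hS _ xc; have [|j hy jy] := hS y; first by rewrite yc.
  have memD (z : induced C) : val z != c -> val z \in enum (C :\ c).
    by move=> zc; rewrite mem_enum !inE zc (valP z).
  have [ij] : Some i = Some j by rewrite -hx -hy.
  apply: val_inj; rewrite -(nth_index c (memD x xc)) -[RHS](nth_index c (memD y _)).
    by rewrite -ix -jy ij.
  by rewrite yc.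
by rewrite /= card_option card_ord card_sig -cardC.
Qed.

Hypothesis no_small : forall C : {set G}, C \in components G -> ~ (#|C| < 3).
Hypothesis no_star : forall C : {set G}, C \in components G ->
  ~ isomorphic (induced C) (star 3).

Lemma decomposable_component (C : {set G}) :
  C \in components G -> decomposable (enum C).
Proof.
move=> CC; have C3 := no_small CC; have Cstar := no_star CC.
case/imsetP: CC => r _ defC.
have CE x : (x \in C) = even_walk r x || odd_walk r x.
  by rewrite defC inE connect_walk.
pose X := [set v | even_walk r v]; pose Y := [set v | odd_walk r v].
have rX : r \in X by rewrite inE even_walk_refl.
have XE u v : u \in X -> v \in X -> even_walk u v.
  by rewrite !inE => hu; apply: even_walk_trans; rewrite even_walk_sym.
have YE u v : u \in Y -> v \in Y -> even_walk u v.
  by rewrite !inE => hu; apply: odd_odd_walk; rewrite odd_walk_sym.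
have XYO u v : u \in X -> v \in Y -> odd_walk u v.
  by rewrite !inE => hu; apply: even_odd_walk; rewrite even_walk_sym.
have CXY : C = X :|: Y by apply/setP=> x; rewrite CE !inE.
(* With an odd closed walk, any two vertices of [C] are joined by walks of both parities, so the
   classes may be chosen freely: for odd order, one vertex against all the others. *)
have [rr|rr] := boolP (odd_walk r r).
  have all_odd : forall x, x \in C -> odd_walk r x.
    by move=> x; rewrite CE => /orP[] // h; apply: odd_even_walk rr h.
  have all_even : forall x, x \in C -> even_walk r x.
    by move=> x /all_odd h; apply: odd_odd_walk rr h.
  have hE : {in C &, forall u v, even_walk u v}.
    by move=> u v /all_even hu /all_even hv; apply: even_walk_trans hv; rewrite even_walk_sym.
  have hO : {in C &, forall u v, odd_walk u v}.
    by move=> u v /all_even hu /all_odd hv; apply: even_odd_walk hv; rewrite even_walk_sym.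
  case e: (enum C) => [|x s]; first by exists [::], [::], [::].
  have inC y : y \in x :: s -> y \in C by rewrite -e mem_enum.
  have sz : size (x :: s) > 2 by rewrite -e -cardE ltnNge; apply/negP.
  have [ev|od] := boolP (odd (size (x :: s))); last first.
    by apply: decomposable_even => // u v /inC hu /inC hv; apply: hE.
  apply: (@decomposable_classes [:: x] s).
  - by move=> u v; rewrite !inE => /eqP -> /eqP ->; apply: even_walk_refl.
  - by move=> u v hu hv; apply: hE; apply: inC; rewrite inE ?hu ?hv orbT.
  - by move=> u v; rewrite inE => /eqP -> hv; apply: hO; apply: inC; rewrite inE ?eqxx ?hv ?orbT.
  - by move: ev sz; rewrite /good_sizes /=; case: (odd _) => //; lia.
(* Without one, [X] and [Y] are the classes of a bipartition. The order excludes sizes (1, 1), and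
   it remains to exclude (1, 3). *)
have dXY : [disjoint X & Y].
  rewrite disjoint_subset; apply/subsetP=> x xX; rewrite inE; apply: contra rr => xY.
  by move: xX xY; rewrite !inE odd_walk_sym; apply: even_odd_walk.
have cardC : #|C| = #|X| + #|Y| by rewrite CXY cardsU disjoint_setI0 // cards0 subn0.
have XY v : v \in X -> v \notin Y by move=> vX; have := disjointFr dXY vX => ->.
have nadjX u v : u \in X -> adj u v -> v \in Y.
  by rewrite !inE => hu /adj_odd_walk; apply: even_odd_walk.
have nadjY u v : u \in Y -> adj u v -> v \in X.
  by rewrite !inE => hu /adj_odd_walk; apply: odd_odd_walk.
have nbr v : v \in C -> exists w, adj v w.
  move=> vC; have : C :\ v != set0.
    rewrite -card_gt0; have := cardsD1 v C; rewrite vC.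
    by move: C3 => /negP; rewrite -leqNgt; lia.
  case/set0Pn=> w; rewrite !inE => /andP[wv]; rewrite defC inE => rw.
  have : connect (@adj G) v w.
    apply: connect_trans rw; rewrite (sym_connect_sym (@adj_sym G)).
    by move: vC; rewrite defC inE.
  case/connectP=> [[|z s]] /=; first by move=> _ e; rewrite e eqxx in wv.
  by case/andP=> vz _ _; exists z.
have [|y0 ry0] := nbr r; first by rewrite CE even_walk_refl.
have y0Y := nadjX _ _ rX ry0.
have Xn0 : 0 < #|X| by rewrite card_gt0; apply/set0Pn; exists r.
have Yn0 : 0 < #|Y| by rewrite card_gt0; apply/set0Pn; exists y0.
(* Each vertex of [B] has a neighbor, which can only be the single vertex [c] of [A]; with three
   vertices in [B] this is the star K_{1,3}. *)
have star1 (A B : {set G}) : C = A :|: B -> [disjoint A & B] ->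
    (forall u v, u \in A -> adj u v -> v \in B) ->
    (forall u v, u \in B -> adj u v -> v \in A) ->
    #|A| = 1 -> #|B| <> 3.
  move=> CAB dAB nA nB /eqP/cards1P[c defA] B3; apply: Cstar.
  have cC : c \in C by rewrite CAB defA !inE eqxx.
  have cB : c \notin B by rewrite (disjointFr dAB) // defA set11.
  apply: (@star_iso C c 3 cC); first by rewrite CAB cardsU disjoint_setI0 // cards0 defA cards1 B3.
  have adjB x : x \in B -> adj x c.
    move=> xB; have [|w xw] := nbr x; first by rewrite CAB inE xB orbT.
    by have := nB _ _ xB xw; rewrite defA inE => /eqP <-.
  move=> x y; rewrite CAB defA !inE.
  case: (eqVneq x c) => [->|xc] /=; case: (eqVneq y c) => [->|yc] //= hx hy.
  - by rewrite adj_irrefl.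
  - by rewrite adj_sym adjB.
  - by rewrite adjB.
  - by apply/negP=> /(nB _ _ hx); rewrite defA inE (negbTE yc).
have s13 := star1 X Y CXY dXY nadjX nadjY.
have s31 : #|Y| = 1 -> #|X| <> 3.
  by apply: (star1 Y X _ _ nadjY nadjX); [rewrite setUC | rewrite disjoint_sym].
apply: (@decomposable_perm (enum X ++ enum Y)).
  apply: uniq_perm; rewrite ?enum_uniq //.
    rewrite cat_uniq !enum_uniq andbT /=; apply/hasPn=> x; rewrite !mem_enum => xY.
    by apply: contraL xY; apply: XY.
  by move=> x; rewrite mem_cat !mem_enum CXY in_setU.
apply: decomposable_classes.
- by move=> u v; rewrite !mem_enum; apply: XE.
- by move=> u v; rewrite !mem_enum; apply: YE.
- by move=> u v; rewrite !mem_enum; apply: XYO.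
rewrite -!cardE; move: C3 Xn0 Yn0 s13 s31; rewrite cardC /good_sizes.
clear; move: #|X| #|Y| => a b.
by case oa: (odd a); case ob: (odd b) => //= *; lia.
Qed.

(** Components are peeled off one at a time from a vertex set closed under connection. *)
Lemma decomposable_graph : decomposable (enum G).
Proof.
suff H (A : {set G}) : {in A, forall x y, connect (@adj G) x y -> y \in A} ->
    decomposable (enum A).
  apply: (@decomposable_perm (enum [set: G])); last by apply: H.
  by apply: uniq_perm; rewrite ?enum_uniq // => x; rewrite !mem_enum in_setT.
have [n] := ubnP #|A|; elim: n A => // n IH A hn clA.
have [->|[r rA]] := set_0Vmem A.
  by rewrite enum_set0; exists [::], [::], [::].
pose C := [set y | connect (@adj G) r y].
have CC : C \in components G by apply: imset_f.
have rC : r \in C by rewrite inE connect0.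
have CA : C \subset A by apply/subsetP=> y; rewrite inE; apply: clA.
apply: (@decomposable_perm (enum C ++ enum (A :\: C))).
  apply: uniq_perm; rewrite ?enum_uniq //.
    rewrite cat_uniq !enum_uniq andbT /=; apply/hasPn=> x.
    by rewrite !mem_enum in_setD => /andP[].
  move=> x; rewrite mem_cat !mem_enum in_setD; case xC: (x \in C) => //=.
  by rewrite (subsetP CA).
apply: decomposable_cat; first exact: decomposable_component.
apply: IH.
  apply: (@leq_trans #|A|); last by rewrite -ltnS.
  apply: proper_card.
  by apply/properP; split; [apply: subsetDl | exists r => //; rewrite inE rC].
move=> x; rewrite in_setD => /andP[xC xA] y xy; rewrite in_setD (clA _ xA _ xy) andbT.
apply: contra xC; rewrite !inE => ry; apply: connect_trans ry _.
by rewrite (sym_connect_sym (@adj_sym G)).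
Qed.

End Decompose.

(** * Distributing group elements over the gadgets *)

Lemma uniq_map_inj (T1 T2 : eqType) (h : T1 -> T2) (s : seq T1) :
  uniq (map h s) -> {in s &, injective h}.
Proof.
elim: s => //= x s IH /andP[hx us] y z; rewrite !inE.
case/orP=> [/eqP->|ys] /orP[/eqP->|zs] // e; last exact: IH.
  by case/negP: hx; rewrite e; apply: map_f.
by case/negP: hx; rewrite -e; apply: map_f.
Qed.

Section Assign.
Local Open Scope ring_scope.
Variables (G : sgraph) (U : finZmodType).
Implicit Types (u v w : G) (a b : U).

Lemma realizable_pair u v a : even_walk u v ->
  realizable (assigned [:: (u, a); (v, - a)]).
Proof.
move=> h; apply: realizable_ext (realizable_even a h) => x.
by rewrite /assigned !big_cons big_nil /= addr0 deltaN.
Qed.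

Lemma realizable_odd_triple u v w a b : odd_walk u v -> odd_walk u w ->
  realizable (assigned [:: (u, a + b); (v, a); (w, b)]).
Proof.
move=> h1 h2; apply: realizable_ext (realizableD (realizable_odd a h1) (realizable_odd b h2)) => x.
by rewrite /assigned !big_cons big_nil /= addr0 deltaD addrACA.
Qed.

Lemma realizable_even_triple u v w a b c : even_walk u v -> even_walk u w ->
  a = - (b + c) -> realizable (assigned [:: (u, a); (v, b); (w, c)]).
Proof.
move=> h1 h2 ->; apply: realizable_ext
  (realizableD (realizable_even (- b) h1) (realizable_even (- c) h2)) => x.
by rewrite /assigned !big_cons big_nil /= addr0 opprD deltaD !deltaN !opprK addrACA.
Qed.

(** The Boolean selects one of the two opposite halves of a six-set; here and in [even_values] the
    first entry belongs to the vertex joined to the other two. *)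
Definition odd_values (i : bool) (t : U * U) : U * U * U :=
  if i then (t.1 + t.2, t.1, t.2) else (- (t.1 + t.2), - t.1, - t.2).

Definition even_values (i : bool) (t : U * U) : U * U * U :=
  if i then (- (t.1 + t.2), t.1, t.2) else (t.1 + t.2, - t.1, - t.2).

Lemma realizable_odd_values s i t : odd_triple s ->
  realizable (assigned (zip (seq3 s : seq G) (seq3 (odd_values i t)))).
Proof.
case: s => [[u v] w] /andP[/= h1 h2]; rewrite /odd_values.
by case: i; rewrite ?opprD; apply: realizable_odd_triple.
Qed.

Lemma realizable_even_values s i t : even_triple s ->
  realizable (assigned (zip (seq3 s : seq G) (seq3 (even_values i t)))).
Proof.
case: s => [[u v] w] /andP[/= h1 h2]; rewrite /even_values.
by case: i; apply: realizable_even_triple; rewrite // -opprD opprK.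
Qed.

(** Each six-set serves two consecutive triples. If the number of triples is odd, the last one uses
    half a six-set and the other half goes to [rest]. The parameter [e] covers both kinds of
    triples. *)
Lemma assign_triples (ok : pred (G * G * G)) (e : bool -> U * U -> U * U * U) :
  (forall t, perm_eq (seq3 (e true t) ++ seq3 (e false t)) (sixset t)) ->
  (forall s i t, ok s -> realizable (assigned (zip (seq3 s : seq G) (seq3 (e i t))))) ->
  forall ts Ss, all ok Ss -> (size Ss <= 2 * size ts)%N ->
  exists (vg : seq (G * U)) rest, [/\ unzip1 vg = flat3 Ss,
    perm_eq (unzip2 vg ++ rest) (sixsets ts) & realizable (assigned vg)].
Proof.
move=> pe re; have unz s t : unzip1 (zip (seq3 (s : G * G * G)) (seq3 (t : U * U * U))) = seq3 s.
  by [].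
have unz2 s t : unzip2 (zip (seq3 (s : G * G * G)) (seq3 (t : U * U * U))) = seq3 t by [].
have nilcase l : exists (vg : seq (G * U)) rest, [/\ unzip1 vg = flat3 [::],
    perm_eq (unzip2 vg ++ rest) l & realizable (assigned vg)].
  exists [::], l; split=> //.
  by apply: realizable_ext (@realizable0 G U) => x; rewrite /assigned big_nil.
elim=> [|t ts IH] [|s1 [|s2 Ss]] // aS sz; try exact: nilcase.
  exists (zip (seq3 s1) (seq3 (e true t))), (seq3 (e false t) ++ sixsets ts).
  case/andP: aS => ok1 _; split => //; last exact: re.
  by rewrite unz2 catA; apply: (perm_cat (pe t)).
move: aS => /= /and3P[ok1 ok2 okS].
have [|vg [rest [h1 h2 h3]]] := IH Ss okS; first by move: sz => /=; lia.
exists (zip (seq3 s1) (seq3 (e true t)) ++ zip (seq3 s2) (seq3 (e false t)) ++ vg), rest.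
split.
- by rewrite /unzip1 !map_cat -!/(unzip1 _) !unz h1.
- rewrite /unzip2 !map_cat -!/(unzip2 _) !unz2 -!catA catA.
  exact: (perm_cat (pe t)).
- by apply: realizable_cat; first exact: re; apply: realizable_cat; first exact: re.
Qed.

Lemma assign_pairs qs Ps : all (@even_pair G) Ps -> (size Ps <= size qs)%N ->
  exists (vg : seq (G * U)) rest, [/\ unzip1 vg = flat2 Ps,
    perm_eq (unzip2 vg ++ rest) (qs ++ map -%R qs) & realizable (assigned vg)].
Proof.
elim: qs Ps => [|q qs IH] [|s Ps] //.
- exists [::], [::]; split=> //.
  by apply: realizable_ext (@realizable0 G U) => x; rewrite /assigned big_nil.
- exists [::], ((q :: qs) ++ map -%R (q :: qs)); split=> //.
  by apply: realizable_ext (@realizable0 G U) => x; rewrite /assigned big_nil.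
case/andP=> h hP sz; have [|vg [rest [h1 h2 h3]]] := IH Ps hP; first by move: sz => /=; lia.
exists ([:: (s.1, q); (s.2, - q)] ++ vg), rest; split.
- by rewrite /= h1.
- apply/seq.permP=> z; have /seq.permP/(_ z) := h2.
  by rewrite /= !count_cat /=; lia.
- by apply: realizable_cat => //; apply: realizable_pair.
Qed.

(** The first [k1] six-sets serve the odd triples, the next [k2] the even ones, and pairs {g, -g}
    the rest; [Os] holds the possible vertex of weight 0. *)
Lemma decomposition_irregular (Os : seq G) Ss Zs Ps k1 k2 : odd #|U| ->
  all (@odd_triple G) Ss -> all (@even_triple G) Zs -> all (@even_pair G) Ps ->
  perm_eq (Os ++ flat3 Ss ++ flat3 Zs ++ flat2 Ps) (enum G) ->
  (size Os <= 1)%N -> (size Ss <= 2 * k1)%N -> (size Zs <= 2 * k2)%N ->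
  (6 * (k1 + k2) + 3 <= #|U|)%N -> (6 * (k1 + k2) + 1 + 2 * size Ps <= #|U|)%N ->
  exists f : {set G} -> U, irregular_labeling f.
Proof.
move=> oddU aS aZ aP pe sO sS sZ c1 c2.
have [ts [qs [sts sqs uu]]] := sixsets_and_pairs oddU c1.
have [||vS [rS [S1 S2 S3]]] := @assign_triples _ odd_values _ realizable_odd_values (take k1 ts) Ss aS.
- by move=> t; apply/seq.permP=> q /=; do 6 case: (q _).
- by rewrite size_takel // sts leq_addr.
have [||vZ [rZ [Z1 Z2 Z3]]] := @assign_triples _ even_values _ realizable_even_values (drop k1 ts) Zs aZ.
- by move=> t; apply/seq.permP=> q /=; do 6 case: (q _).
- by rewrite size_drop sts addKn.
have [|vP [rP [P1 P2 P3]]] := @assign_pairs qs Ps aP; first by move: c2; rewrite -sqs; move: (size qs) (size Ps) => a b; lia.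
pose vO := [seq (u, 0 : U) | u <- Os].
have O1 : unzip1 vO = Os by rewrite /unzip1 -map_comp map_id.
have O3 : realizable (assigned vO).
  apply: realizable_ext (@realizable0 G U) => x; rewrite /assigned /vO big_map big1 // => u _.
  by rewrite /delta if_same.
pose vg := vO ++ vS ++ vZ ++ vP.
have V1 : perm_eq (unzip1 vg) (enum G).
  by rewrite /unzip1 !map_cat -!/(unzip1 _) O1 S1 Z1 P1.
have V3 : realizable (assigned vg) by do !apply: realizable_cat.
have V2 : uniq (unzip2 vg).
  have [rO pO] : exists rO, perm_eq (unzip2 vO ++ rO) [:: 0].
    rewrite /vO; case: (Os) sO => [|u [|]] //= _; [by exists [:: 0] | by exists [::]].
  apply: (@subseq_uniq _ _ (unzip2 vg ++ (rO ++ rS ++ rZ ++ rP))); first exact: prefix_subseq.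
  rewrite -(perm_uniq (_ : perm_eq (0 :: sixsets ts ++ qs ++ map -%R qs) _)) //.
  rewrite perm_sym -(cat_take_drop k1 ts) sixsets_cat -cat1s.
  rewrite /unzip2 !map_cat -!/(unzip2 _).
  apply: perm_trans (perm_cat pO (perm_cat (perm_cat S2 Z2) P2)).
  by apply/seq.permP=> q; rewrite !count_cat; ring.
have [f fE] := V3; exists f => u v; rewrite !fE; apply: contraNneq.
have u1 : uniq (unzip1 vg) by rewrite (perm_uniq V1) enum_uniq.
have ex x : exists a, (x, a) \in vg.
  have : x \in unzip1 vg by rewrite (perm_mem V1) mem_enum.
  by case/mapP=> -[y a] h /= ->; exists a.
have [a ha] := ex u; have [b hb] := ex v.
rewrite (assigned_mem u1 ha) (assigned_mem u1 hb) => ab.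
by have [->] := uniq_map_inj V2 ha hb ab.
Qed.

End Assign.

(** * Bounds on the group irregularity strength *)

(** Descent to the least order; [group_irregular] is a proposition, so the existence of a smaller
    order is decided by excluded middle. *)
Lemma strength_exists (G : sgraph) s : 0 < s -> group_irregular G s ->
  exists2 t, is_group_irregularity_strength G t & t <= s.
Proof.
elim/ltn_ind: s => s IH s0 hs.
have [[t [ts t0 ht]]|no] := classic (exists t, [/\ t < s, 0 < t & group_irregular G t]).
  by have [r hr rt] := IH t ts t0 ht; exists r => //; apply: leq_trans rt (ltnW ts).
exists s => //; split=> // t t0 ht; rewrite leqNgt; apply/negP=> ts.
by apply: no; exists t.
Qed.

(** The cyclic group of order t alone gives the bound, since the weights inject the vertices into
    it. *)
Lemma group_irregular_order (G : sgraph) t : 0 < t -> group_irregular G t -> #|G| <= t.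
Proof.
case: t => // t _ /(_ 'I_t.+1 (card_ord _)) [f irr].
rewrite -[X in _ <= X]card_ord; apply: (@leq_card _ _ (weight f)).
by move=> u v; apply: contra_eq; apply: irr.
Qed.

(* The parities of the numbers of triples are corrected with the element 0: a
   triple becomes a vertex of weight 0 and a pair. *)
Lemma group_irregular_odd (G : sgraph) n : #|G| = n ->
  (forall C : {set G}, C \in components G -> ~ (#|C| < 3)) ->
  (forall C : {set G}, C \in components G -> ~ isomorphic (induced C) (star 3)) ->
  group_irregular G (if odd n then n else n + 3).
Proof.
move=> cG no_small no_star U cU.
have [Ss [Zs [Ps [aS aZ aP pe]]]] := decomposable_graph no_small no_star.
have sz : 3 * size Ss + 3 * size Zs + 2 * size Ps = n.
  by have := perm_size pe; rewrite -cardE cG !size_cat !size_flat3 size_flat2 addnA.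
have oddU : odd #|U| by rewrite cU; case: ifP => // h; rewrite oddD h.
have [oZ|eZ] := boolP (odd (size Zs)).
  case: Zs oZ aZ pe sz => // -[[u v] w] Zs /= oZ /andP[/andP[/= uv uw] aZ].
  move=> pe sz.
  apply: (@decomposition_irregular _ _ [:: u] Ss Zs ((v, w) :: Ps)
    (uphalf (size Ss)) (size Zs)./2) => //=.
  - rewrite aP andbT /even_pair /=.
    by apply: even_walk_trans uw; rewrite even_walk_sym.
  - apply: perm_trans pe.
    change (perm_eq ([:: u] ++ flat3 Ss ++ flat3 Zs ++ [:: v; w] ++ flat2 Ps)
                    (flat3 Ss ++ ([:: u; v; w] ++ flat3 Zs) ++ flat2 Ps)).
    by apply/seq.permP=> q; rewrite !count_cat /=; ring.
  - lia.
  - lia.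
  - rewrite cU; case: ifP; lia.
  - rewrite cU; case: ifP; lia.
have [on|en] := boolP (odd n); last first.
  (* For even n and an even number of even triples, the number of odd triples is even too, and no
     correction is made. *)
  apply: (@decomposition_irregular _ _ [::] Ss Zs Ps
    (uphalf (size Ss)) (size Zs)./2) => //=; rewrite ?cU ?(negbTE en); lia.
(* For odd n and an even number of even triples, the number of odd triples is odd, so there is one
   to break up; its last two vertices are joined by an even walk. *)
case: Ss aS pe sz => [|[[u v] w] Ss] /=; first by lia.
move=> /andP[/andP[/= uv uw] aS] pe sz.
apply: (@decomposition_irregular _ _ [:: u] Ss Zs ((v, w) :: Ps)
    (uphalf (size Ss)) (size Zs)./2) => //=.
- rewrite aP andbT /even_pair /=.
  by apply: odd_odd_walk uw; rewrite odd_walk_sym.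
- apply: perm_trans pe.
  change (perm_eq ([:: u] ++ flat3 Ss ++ flat3 Zs ++ [:: v; w] ++ flat2 Ps)
                  (([:: u; v; w] ++ flat3 Ss) ++ flat3 Zs ++ flat2 Ps)).
  by apply/seq.permP=> q; rewrite !count_cat /=; ring.
- lia.
- lia.
- rewrite cU on; lia.
- rewrite cU on; lia.
Qed.

Unset Implicit Arguments.

Theorem theorem2p6 (G : sgraph) (n : nat) (order_G : #|G| = n)
  (no_small : forall C : {set G}, C \in components G -> ~ (#|C| < 3))
  (no_star : forall (C : {set G}) (u : nat), C \in components G ->
     u \in [:: 1; 2] -> ~ isomorphic (induced C) (star (1 + 2 * u))) :
  (n = 1 %[mod 2] -> is_group_irregularity_strength G n) /\
  (n = 0 %[mod 2] ->
     exists2 s : nat, is_group_irregularity_strength G s & s <= n + 3).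
Proof.
have irr := group_irregular_odd order_G no_small
  (fun C CC => no_star C 1 CC (mem_head 1 [:: 2])).
rewrite !modn2 /=; split=> nE.
  have n_odd : odd n by case: (odd n) nE.
  rewrite n_odd in irr; split=> //; first by case: (n) n_odd.
  by move=> t t0 ht; rewrite -order_G; apply: group_irregular_order.
have n_even : odd n = false by case: (odd n) nE.
by rewrite n_even in irr; apply: strength_exists irr; rewrite addn3.
Qed.
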